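(* Let $H$ be the honeycomb graph with white vertices $w_{x,y}=(x-\tfrac14,y-\tfrac14)$ and black vertices $b_{x,y}=(x+\tfrac14,y+\tfrac14)$, $(x,y)\in\mathbb Z^2$, and straight edges $b_{x,y}w_{x,y}$, $b_{x,y}w_{x+1,y}$, $b_{x,y}w_{x,y+1}$. Let $A,B$ be real $2\times2$ invertible matrices and take the connection $\phi_{b_{x,y}w_{x,y}}=I$, $\phi_{b_{x,y}w_{x+1,y}}=A$, $\phi_{b_{x,y}w_{x,y+1}}=B$. Take cilia as follows: at $w_{x,y}$ the cilium is the wedge containing the upward direction $(0,1)$ (between the edges to $b_{x,y}$ and to $b_{x-1,y}$); at $b_{x,y}$ the cilium is the wedge containing the direction $(-1,0)$ (between the edges to $w_{x,y}$ and to $w_{x,y+1}$). Suppose that among the three matrices $A$, $B$, $AB^{-1}$, either exactly two have both eigenvalues real and positive and the third has both eigenvalues real and negative, or all three have both eigenvalues real and negative. Then for every finite subgraph $\mathcal H$ of $H$ with equally many black and white vertices, equipped with the restricted connection and the induced cilia (at each vertex, the wedge of $\mathcal H$ containing the same direction), every $2$-multiweb $m\in\Omega_{\mathbf 2}(\mathcal H)$ (multiplicity $n_v=2$ at all vertices) has $\mathrm{Tr}_\Phi(m)>0$.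
   Context: An $\mathbf n$-multiweb on a bipartite graph with multiplicities $n_v$ is a function $m:E\to\mathbb Z_{\ge0}$ with $\sum_{u\sim v}m_{uv}=n_v$ for every vertex $v$. The connection matrix $\phi_{bw}$ is viewed as a linear map $\mathbb R^{2}\to\mathbb R^{2}$ from the black to the white endpoint. The cilium at $v$ determines the ''edge order'' at $v$: at a black vertex, counterclockwise starting just after the cilium; at a white vertex, clockwise starting just after the cilium. Trace. Let $\mathcal C_v=\{1,\dots,n_v\}$. A coloring of $m$ assigns to each edge $e=bw$ with $m_e>0$ subsets $S_e\subset\mathcal C_b$, $T_e\subset\mathcal C_w$ of size $m_e$ such that at each black $b$ the sets $S_{bw}$ partition $\mathcal C_b$ and at each white $w$ the sets $T_{bw}$ partition $\mathcal C_w$. The sign $c_b$ is the signature of the permutation of $\mathcal C_b$ obtained by listing the sets $S_{bw}$ in the edge order at $b$, each in increasing order; $c_w$ is defined likewise with the sets $T_{bw}$ in the edge order at $w$. Then $\mathrm{Tr}_\Phi(m)=\sum_C\prod_v c_v\prod_{e=bw:\,m_e>0}\det[(\phi_{bw})_{T_e,S_e}]$, summing over colorings $C$, where $(\phi)_{T,S}$ is the submatrix with rows $T$ and columns $S$ in increasing order. *)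

(* Defs.v *)
From HB Require Import structures.
From mathcomp Require Import all_boot all_order all_algebra.
From mathcomp Require Import reals.
Set Implicit Arguments. Unset Strict Implicit. Unset Printing Implicit Defensive.
Import Order.TTheory GRing.Theory Num.Theory.
Local Open Scope ring_scope.

(* An edge of the honeycomb H: ((x,y), k) is the edge from b_{x,y} to
   w_{x,y} (k = 0), w_{x+1,y} (k = 1), w_{x,y+1} (k = 2). *)
Definition hedge := ((int * int) * 'I_3)%type.

Definition hshift (k : 'I_3) : int * int :=
  if val k == 0%N then (0, 0) else if val k == 1%N then (1, 0) else (0, 1).

Definition hblack (e : hedge) : int * int := e.1.
Definition hwhite (e : hedge) : int * int :=
  (e.1.1 + (hshift e.2).1, e.1.2 + (hshift e.2).2).

Definition hconn (R : numFieldType) (A B : 'M[R]_2) (e : hedge) : 'M[R]_2 :=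
  if val e.2 == 0%N then 1%:M else if val e.2 == 1%N then A else B.

Definition honeycomb_subgraph (Bs Ws : seq (int * int)) (E : seq hedge) : bool :=
  [&& uniq Bs, uniq Ws, uniq E &
      all (fun e => (hblack e \in Bs) && (hwhite e \in Ws)) E].

(* m is a 2-multiweb of (Bs, Ws, E) (only its values on E matter). *)
Definition is_2multiweb (Bs Ws : seq (int * int)) (E : seq hedge) (m : hedge -> nat) : Prop :=
  (forall p, p \in Bs -> (\sum_(e <- E | hblack e == p) m e)%N = 2%N) /\
  (forall q, q \in Ws -> (\sum_(e <- E | hwhite e == q) m e)%N = 2%N).

Definition he0 : hedge := ((0, 0), ord0).
Definition eE (E : seq hedge) (i : 'I_(size E)) : hedge := nth he0 E i.
Arguments eE : clear implicits.

(* Edges of the subgraph at a black vertex, in edge order (ccw after the cilium,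
   which points in direction (-1,0)): types 0, 1, 2. *)
Definition black_incident (E : seq hedge) (p : int * int) : seq 'I_(size E) :=
  flatten [seq [seq i <- enum 'I_(size E) |
                  (hblack (eE E i) == p) && (val (eE E i).2 == k)] | k <- [:: 0; 1; 2]%N].

(* Edges at a white vertex, in edge order (cw after the cilium, which points in
   direction (0,1)): to b_{x,y} (type 0), to b_{x,y-1} (type 2), to b_{x-1,y} (type 1). *)
Definition white_incident (E : seq hedge) (q : int * int) : seq 'I_(size E) :=
  flatten [seq [seq i <- enum 'I_(size E) |
                  (hwhite (eE E i) == q) && (val (eE E i).2 == k)] | k <- [:: 0; 2; 1]%N].

(* colors C_v = {1,2} are represented by 'I_2; a set listed in increasing order *)
Definition sorted_colors (S : {set 'I_2}) : seq 'I_2 :=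
  sort (fun i j : 'I_2 => (i <= j)%N) (enum S).

Definition ninv (s : seq 'I_2) : nat :=
  (\sum_(i < size s) \sum_(j < size s | (i < j)%N) (nth ord0 s j < nth ord0 s i))%N.
Definition seq_sign (R : numFieldType) (s : seq 'I_2) : R := (-1) ^+ ninv s.

Definition coloring (E : seq hedge) := {ffun 'I_(size E) -> {set 'I_2} * {set 'I_2}}.

Definition black_word (E : seq hedge) (c : coloring E) (p : int * int) : seq 'I_2 :=
  flatten [seq sorted_colors (c i).1 | i <- black_incident E p].
Definition white_word (E : seq hedge) (c : coloring E) (q : int * int) : seq 'I_2 :=
  flatten [seq sorted_colors (c i).2 | i <- white_incident E q].
Arguments black_word : clear implicits.
Arguments white_word : clear implicits.

(* |S_e| = |T_e| = m_e, and the S's (resp. T's) at each vertex partition the colors,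
   i.e. listing them in edge order gives a permutation of {1,2}. *)
Definition valid_coloring (Bs Ws : seq (int * int)) (E : seq hedge) (m : hedge -> nat)
    (c : coloring E) : bool :=
  [&& [forall i, (#|(c i).1| == m (eE E i)) && (#|(c i).2| == m (eE E i))],
      all (fun p => perm_eq (black_word E c p) (enum 'I_2)) Bs &
      all (fun q => perm_eq (white_word E c q) (enum 'I_2)) Ws].

(* det of the submatrix with rows T, columns S (both of size k), increasing order *)
Definition minor (R : numFieldType) (M : 'M[R]_2) (T S : {set 'I_2}) (k : nat) : R :=
  \det (\matrix_(i < k, j < k)
          M (nth ord0 (sorted_colors T) i) (nth ord0 (sorted_colors S) j)).

Definition trace2 (R : numFieldType) (A B : 'M[R]_2) (Bs Ws : seq (int * int))
    (E : seq hedge) (m : hedge -> nat) : R :=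
  \sum_(c : coloring E | valid_coloring Bs Ws m c)
    ((\prod_(p <- Bs) seq_sign R (black_word E c p)) *
     (\prod_(q <- Ws) seq_sign R (white_word E c q)) *
     \prod_(i < size E | (0 < m (eE E i))%N)
        minor (hconn A B (eE E i)) (c i).2 (c i).1 (m (eE E i))).

Definition eig_pos (R : realType) (M : 'M[R]_2) : Prop :=
  exists l1 l2 : R, [/\ 0 < l1, 0 < l2 & char_poly M = ('X - l1%:P) * ('X - l2%:P)].
Definition eig_neg (R : realType) (M : 'M[R]_2) : Prop :=
  exists l1 l2 : R, [/\ l1 < 0, l2 < 0 & char_poly M = ('X - l1%:P) * ('X - l2%:P)].

Definition sign_condition (R : realType) (A B : 'M[R]_2) : Prop :=
  let C := A *m invmx B in
  [\/ [/\ eig_pos A, eig_pos B & eig_neg C],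
      [/\ eig_pos A, eig_neg B & eig_pos C],
      [/\ eig_neg A, eig_pos B & eig_pos C] |
      [/\ eig_neg A, eig_neg B & eig_neg C]].

(* Main.v *)
Require Import Defs.
From HB Require Import structures.
From mathcomp Require Import all_boot all_order all_algebra.
From mathcomp Require Import reals ring zify.
Set Implicit Arguments. Unset Strict Implicit. Unset Printing Implicit Defensive.
Import Order.TTheory GRing.Theory Num.Theory.
Local Open Scope ring_scope.

(** The trace is the contraction of a tensor network, and the point is to choose,
    on each type of edge, a rank-one decomposition of the connection matrix into
    two terms for which every local contraction has the same sign.

    Replacing [A] by [-A] or [B] by [-B] does not change the trace: the edges of a
    given type have even total multiplicity, because that multiplicity is twice
    the difference of the coordinate sums of the white and of the black vertices.
    Hence [A] and [B] may be taken with positive and [A B^-1] with negative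
    eigenvalues.

    Take row vectors with f A = a f, g B = b g and u A = c u B, where a and b are
    positive and c is negative, and put v = u B.  No two of u, f, g are
    proportional, so that, after rescaling f and g, the determinants det(u, f),
    det(u, g) and det(f, g) have the same sign, and then det(f, v) and det(v, g)
    have that sign too.  Expanding the identity in the basis (f, g), [A] in the
    basis (u, f) and [B] in the basis (u, g) gives the rank-one terms.  Up to
    positive factors, the vectors at the black ends are f and -g for the identity,
    v and f for [A], g and v for [B]; those at the white ends are the covectors of
    -g and -f, of f and u, of u and -g.  In the cilium order, their determinants all
    have the common sign or vanish.  This sign occurs once per vertex, an even
    number of times.

    Expanding every edge of multiplicity 1, the sum over colorings factors over
    the vertices into such determinants, and one choice of the terms makes all of
    them nonzero. *)

Lemma forall_ord2 (P : 'I_2 -> Prop) : P 0 -> P 1 -> forall i, P i.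
Proof.
by move=> P0 P1 [[|[|//]] i2]; [move: P0 | move: P1]; congr P; apply: val_inj.
Qed.

Lemma sum_ord2 (V : nmodType) (F : 'I_2 -> V) : \sum_i F i = F 0 + F 1.
Proof. by rewrite big_ord_recl big_ord1; congr (_ + F _); apply: val_inj. Qed.

Lemma enum_ord2 : enum 'I_2 = [:: 0; 1].
Proof. by rewrite !enum_ordSl enum_ord0; congr [:: _; _]; apply: val_inj. Qed.

Lemma det_mx22 (R : comPzRingType) (M : 'M[R]_2) :
  \det M = M 0 0 * M 1 1 - M 0 1 * M 1 0.
Proof.
rewrite (expand_det_row _ 0) sum_ord2 /cofactor !det_mx11 !mxE /=.
rewrite expr0 expr1 mul1r mulN1r mulrN.
by congr (_ * M _ _ - _ * M _ _); apply: val_inj.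
Qed.

(** * Wedge products of plane vectors *)

Section Wedge.
Variable R : comPzRingType.
Implicit Types (x y : 'rV[R]_2) (M : 'M[R]_2).

Definition wedge x y : R := x 0 0 * y 0 1 - x 0 1 * y 0 0.

(* The functional [wedge x], as a row vector. *)
Definition perp x : 'rV_2 := \row_j (if j == 0 then - x 0 1 else x 0 0).

Lemma wedgeC x y : wedge y x = - wedge x y.
Proof. by rewrite /wedge; ring. Qed.

Lemma wedgexx x : wedge x x = 0.
Proof. by rewrite /wedge; ring. Qed.

Lemma wedgeZl a x y : wedge (a *: x) y = a * wedge x y.
Proof. by rewrite /wedge !mxE; ring. Qed.

Lemma wedgeZr a x y : wedge x (a *: y) = a * wedge x y.
Proof. by rewrite /wedge !mxE; ring. Qed.

Lemma wedgeNl x y : wedge (- x) y = - wedge x y.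
Proof. by rewrite -scaleN1r wedgeZl mulN1r. Qed.

Lemma perpN x : perp (- x) = - perp x.
Proof. by apply/rowP; elim/forall_ord2; rewrite !mxE. Qed.

Lemma wedge_perp x y : wedge (perp x) (perp y) = wedge x y.
Proof. by rewrite /wedge !mxE /=; ring. Qed.

Lemma wedge_mulmx M x y : wedge (x *m M) (y *m M) = wedge x y * \det M.
Proof. by rewrite /wedge det_mx22 !mxE !sum_ord2; ring. Qed.

Lemma wedge_scale_mx M x y :
  wedge x y *: M = (perp x)^T *m (y *m M) - (perp y)^T *m (x *m M).
Proof.
rewrite !mulmxA -mulmxBl -mul_scalar_mx; congr (_ *m M).
by apply/matrixP; elim/forall_ord2; elim/forall_ord2;
  rewrite !mxE !big_ord1 !mxE /= /wedge; ring.
Qed.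

End Wedge.

Section EigenvectorsInThePlane.
Variable F : fieldType.
Implicit Types (x y : 'rV[F]_2) (M : 'M[F]_2).

Lemma wedge_eq0_scale x y : wedge x y = 0 -> x != 0 -> exists c, y = c *: x.
Proof.
move=> /subr0_eq xy0 /rV0Pn [i xi0].
have xyC j k : x 0 j * y 0 k = x 0 k * y 0 j by move: j k; do 2!elim/forall_ord2.
exists (y 0 i / x 0 i); apply/rowP=> j.
by rewrite mxE mulrAC [y 0 i * _]mulrC xyC mulrAC mulfV // mul1r.
Qed.

Lemma eigenvector_wedge_eq0 M l x y :
  wedge x y = 0 -> x != 0 -> y != 0 -> y *m M = l *: y -> x *m M = l *: x.
Proof.
move=> xy0 x0 y0 yM; have [k xE] : exists k, x = k *: y.
  by apply: wedge_eq0_scale y0; rewrite wedgeC xy0 oppr0.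
by rewrite xE -scalemxAl yM !scalerA mulrC.
Qed.

Lemma eigenvalue_char_poly2 M l1 l2 l :
  char_poly M = ('X - l1%:P) * ('X - l2%:P) ->
  eigenvalue M l = (l == l1) || (l == l2).
Proof. by rewrite eigenvalue_root_char => ->; rewrite rootM !root_XsubC. Qed.

Lemma det_char_poly2 M l1 l2 :
  char_poly M = ('X - l1%:P) * ('X - l2%:P) -> \det M = l1 * l2.
Proof.
move=> chM; have := char_poly_det M.
by rewrite chM -horner_coef0 !hornerE /= sqrrN expr1n mul1r mulrNN => <-.
Qed.

Lemma char_poly2_opp M l1 l2 :
  char_poly M = ('X - l1%:P) * ('X - l2%:P) ->
  char_poly (- M) = ('X - (- l1)%:P) * ('X - (- l2)%:P).
Proof.
rewrite /char_poly !det_mx22 !mxE /= !mulr1n !mulr0n !sub0r.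
move=> /(congr1 (fun p => p \Po (- 'X))).
rewrite !(comp_polyM, comp_polyB, comp_polyX, comp_polyC, rmorphN) /= => chM.
transitivity ((- 'X - l1%:P) * (- 'X - l2%:P)); last by ring.
by rewrite -chM ?comp_polyC; ring.
Qed.

End EigenvectorsInThePlane.

Section SignedSpectrum.
Variable R : realType.
Implicit Types (M : 'M[R]_2) (l : R).

Lemma eig_pos_eigenvalue M : eig_pos M -> exists2 l, 0 < l & eigenvalue M l.
Proof.
move=> [l1 [l2 [l1_gt0 _ chM]]]; exists l1 => //.
by rewrite (eigenvalue_char_poly2 _ chM) eqxx.
Qed.

Lemma eig_neg_eigenvalue M : eig_neg M -> exists2 l, l < 0 & eigenvalue M l.
Proof.
move=> [l1 [l2 [l1_lt0 _ chM]]]; exists l1 => //.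
by rewrite (eigenvalue_char_poly2 _ chM) eqxx.
Qed.

Lemma eigenvalue_eig_pos_gt0 M l : eig_pos M -> eigenvalue M l -> 0 < l.
Proof.
by move=> [l1 [l2 [? ? chM]]]; rewrite (eigenvalue_char_poly2 _ chM) => /orP [] /eqP ->.
Qed.

Lemma eigenvalue_eig_neg_lt0 M l : eig_neg M -> eigenvalue M l -> l < 0.
Proof.
by move=> [l1 [l2 [? ? chM]]]; rewrite (eigenvalue_char_poly2 _ chM) => /orP [] /eqP ->.
Qed.

Lemma eig_pos_det_gt0 M : eig_pos M -> 0 < \det M.
Proof. by move=> [l1 [l2 [? ? chM]]]; rewrite (det_char_poly2 chM) mulr_gt0. Qed.

Lemma eig_pos_opp M : eig_pos M -> eig_neg (- M).
Proof.
move=> [l1 [l2 [l1_gt0 l2_gt0 /char_poly2_opp chM]]]; exists (- l1), (- l2).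
by rewrite !oppr_lt0.
Qed.

Lemma eig_neg_opp M : eig_neg M -> eig_pos (- M).
Proof.
move=> [l1 [l2 [l1_lt0 l2_lt0 /char_poly2_opp chM]]]; exists (- l1), (- l2).
by rewrite !oppr_gt0.
Qed.

End SignedSpectrum.

(** * Positive frames *)

Section PositiveFrames.
Variable R : realFieldType.
Implicit Types (eta : bool) (x y z : 'rV[R]_2).

Definition oriented eta x y : bool := 0 < (-1) ^+ eta * wedge x y.

Lemma oriented_oppl eta x y : oriented eta (- x) y = oriented eta y x.
Proof. by rewrite /oriented wedgeNl -wedgeC. Qed.

Lemma oriented_neq0 eta x y : oriented eta x y -> wedge x y != 0.
Proof. by rewrite /oriented; apply: contraTneq => ->; rewrite mulr0 ltxx. Qed.

Lemma oriented_div_gt0 eta s x y :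
  0 < s -> oriented eta x y -> 0 < (-1) ^+ eta * (s / wedge x y).
Proof.
move=> s_gt0 xy; rewrite mulrCA pmulr_rgt0 //.
by rewrite -[_ ^+ _]invr_sign -invfM invr_gt0.
Qed.

Definition positive_pair eta (X Y : bool -> 'rV[R]_2) : bool :=
  [forall r, forall s, 0 <= (-1) ^+ eta * wedge (X r) (Y s)] &&
  oriented eta (X false) (Y false).

Lemma positive_pair_scale_perp eta (c d : bool -> R) (X Y : bool -> 'rV[R]_2) :
  (forall r, 0 < (-1) ^+ eta * c r) -> (forall r, 0 < (-1) ^+ eta * d r) ->
  positive_pair eta X Y ->
  positive_pair eta (fun r => c r *: perp (X r)) (fun r => d r *: perp (Y r)).
Proof.
move=> c_gt0 d_gt0 /andP [/forallP XY_ge0 XY_gt0].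
have wedgeE r s : (-1) ^+ eta * wedge (c r *: perp (X r)) (d s *: perp (Y s)) =
    ((-1) ^+ eta * c r) * ((-1) ^+ eta * d s) * ((-1) ^+ eta * wedge (X r) (Y s)).
  rewrite wedgeZl wedgeZr wedge_perp.
  set t := (-1) ^+ eta; transitivity (t * t * (t * (c r * (d s * wedge (X r) (Y s))))).
    by rewrite -expr2 sqrr_sign mul1r.
  by ring.
apply/andP; split; last first.
  by rewrite /oriented wedgeE mulr_gt0 // mulr_gt0.
apply/forallP=> r; apply/forallP=> s; rewrite wedgeE mulr_ge0 //.
  by rewrite mulr_ge0 ?ltW.
by have /forallP := XY_ge0 r; apply.
Qed.

Definition cyclic_frame x y z (k : nat) (r : bool) : 'rV[R]_2 :=
  match k with
  | 0 => if r then - z else x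
  | 1 => if r then x else y
  | _ => if r then y else z
  end.

Lemma pairwise_cyclic_frame eta x y z :
  pairwise (oriented eta) [:: x; y; z] ->
  pairwise (fun k l => positive_pair eta (cyclic_frame x y z k) (cyclic_frame x y z l))
    [:: 0; 1; 2]%N.
Proof.
rewrite /= !andbT /oriented => /andP [/andP [xy xz] yz].
have yx : 0 <= (-1) ^+ eta * - wedge y x by rewrite -wedgeC ltW.
have zx : 0 <= (-1) ^+ eta * - wedge z x by rewrite -wedgeC ltW.
have zy : 0 <= (-1) ^+ eta * - wedge z y by rewrite -wedgeC ltW.
rewrite /positive_pair /oriented /= xy xz yz !andbT -andbA.
apply/and3P; split; apply/forallP=> -[]; apply/forallP=> -[] /=;
  by rewrite ?wedgeNl ?wedgexx ?oppr0 ?mulr0 // ltW.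
Qed.

End PositiveFrames.

(* The scalars are chosen so that each wedge becomes the product of the three original
   ones, up to a square. *)
Lemma exists_oriented_scaling (R : realFieldType) (u x y : 'rV[R]_2) :
  wedge u x != 0 -> wedge u y != 0 -> wedge x y != 0 ->
  exists eta s t, [/\ oriented eta u (s *: x), oriented eta u (t *: y) &
    oriented eta (s *: x) (t *: y)].
Proof.
set p := wedge u x; set q := wedge u y; set r := wedge x y => p0 q0 r0.
pose d := p * q * r; exists (d < 0), (q * r), (p * r).
have d_gt0 : 0 < (-1) ^+ (d < 0)%R * d by rewrite -normrEsign normr_gt0 !mulf_neq0.
rewrite /oriented !wedgeZl !wedgeZr -/p -/q -/r.
have -> : q * r * p = d by rewrite /d; ring.
have -> : p * r * q = d by rewrite /d; ring.
have -> : q * r * (p * r * r) = d * r ^+ 2 by rewrite /d; ring.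
by split=> //; rewrite mulrA mulr_gt0 // exprn_even_gt0.
Qed.

Record eigenframe (R : realFieldType) (A B : 'M[R]_2) (eta : bool) (u f g : 'rV[R]_2)
    (a b c : R) : Prop := Eigenframe {
  eigenframe_a_gt0 : 0 < a;
  eigenframe_b_gt0 : 0 < b;
  eigenframe_c_lt0 : c < 0;
  eigenframe_A : f *m A = a *: f;
  eigenframe_B : g *m B = b *: g;
  eigenframe_pencil : u *m A = c *: (u *m B);
  eigenframe_uf : oriented eta u f;
  eigenframe_ug : oriented eta u g;
  eigenframe_fg : oriented eta f g }.

Section ExistsEigenframe.
Variables (R : realType) (A B : 'M[R]_2).
Hypotheses (unitB : B \in unitmx) (posA : eig_pos A) (posB : eig_pos B).
Hypothesis negAB : eig_neg (A *m invmx B).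

Lemma no_common_eigenvector (x : 'rV_2) a b :
  x != 0 -> x *m A = a *: x -> x *m B = b *: x -> False.
Proof.
move=> x0 xA xB.
have a_gt0 : 0 < a by apply: (eigenvalue_eig_pos_gt0 posA); apply/eigenvalueP; exists x.
have b_gt0 : 0 < b by apply: (eigenvalue_eig_pos_gt0 posB); apply/eigenvalueP; exists x.
suff : eigenvalue (A *m invmx B) (a / b).
  by move=> /(eigenvalue_eig_neg_lt0 negAB); rewrite ltNge ltW // divr_gt0.
apply/eigenvalueP; exists x => //.
apply: (can_inj (mulmxK unitB)).
by rewrite mulmxA mulmxKV // xA -scalemxAl xB scalerA divfK ?gt_eqF.
Qed.

Lemma exists_eigenframe : exists eta u f g a b c, eigenframe A B eta u f g a b c.
Proof.
have [a a_gt0 /eigenvalueP [f fA f0]] := eig_pos_eigenvalue posA.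
have [b b_gt0 /eigenvalueP [g gB g0]] := eig_pos_eigenvalue posB.
have [c c_lt0 /eigenvalueP [u uC u0]] := eig_neg_eigenvalue negAB.
have uA : u *m A = c *: (u *m B) by rewrite scalemxAl -uC mulmxA mulmxKV.
have fg : wedge f g != 0.
  apply/eqP=> fg0; have fB := eigenvector_wedge_eq0 fg0 f0 g0 gB.
  exact: no_common_eigenvector f0 fA fB.
have uf : wedge u f != 0.
  apply/eqP=> uf0; have uAa := eigenvector_wedge_eq0 uf0 u0 f0 fA.
  apply: (no_common_eigenvector u0 uAa (_ : _ = (c^-1 * a) *: u)).
  by rewrite -scalerA -uAa uA scalerK ?lt_eqF.
have ug : wedge u g != 0.
  apply/eqP=> ug0; have uB := eigenvector_wedge_eq0 ug0 u0 g0 gB.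
  apply: (no_common_eigenvector u0 (_ : _ = (c * b) *: u) uB).
  by rewrite uA uB scalerA.
have [eta [s [t [usf utg sftg]]]] := exists_oriented_scaling uf ug fg.
exists eta, u, (s *: f), (t *: g), a, b, c; split=> //.
  by rewrite -scalemxAl fA !scalerA mulrC.
by rewrite -scalemxAl gB !scalerA mulrC.
Qed.

End ExistsEigenframe.

(* [q] gives the vectors at the black ends of the edges of each type and [p] those at the
   white ends, where the cilium order of the types is 0, 2, 1. *)
Definition edge_frames (R : realFieldType) (A B : 'M[R]_2) (eta : bool)
    (q p : nat -> bool -> 'rV[R]_2) : Prop :=
  [/\ pairwise (fun k l => positive_pair eta (q k) (q l)) [:: 0; 1; 2]%N,
      pairwise (fun k l => positive_pair eta (p k) (p l)) [:: 0; 2; 1]%N &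
      forall e : hedge, hconn A B e = \sum_r (p (val e.2) r)^T *m q (val e.2) r].

Section EigenframeDecomposition.
Variables (R : realFieldType) (A B : 'M[R]_2).
Variables (eta : bool) (u f g : 'rV[R]_2) (a b c : R).
Hypotheses (detA_gt0 : 0 < \det A) (detB_gt0 : 0 < \det B).
Hypothesis frame : eigenframe A B eta u f g a b c.

Let v := u *m B.

Lemma pairwise_oriented_fvg : pairwise (oriented eta) [:: f; v; g].
Proof.
have [a_gt0 b_gt0 c_lt0 fA gB uA uf ug fg] := frame.
have fv : oriented eta f v.
  have : wedge (u *m A) (f *m A) = wedge u f * \det A by exact: wedge_mulmx.
  rewrite uA fA -/v wedgeZl wedgeZr [wedge v f]wedgeC /oriented => detAE.
  have : 0 < (-1) ^+ eta * wedge u f * \det A by rewrite mulr_gt0.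
  rewrite -mulrA -detAE; have -> : (-1) ^+ eta * (c * (a * - wedge f v)) =
    - c * a * ((-1) ^+ eta * wedge f v) :> R by ring.
  by rewrite pmulr_rgt0 // mulr_gt0 // oppr_gt0.
have vg : oriented eta v g.
  have : wedge v (g *m B) = wedge u g * \det B by exact: wedge_mulmx.
  rewrite gB wedgeZr /oriented => detBE.
  have : 0 < (-1) ^+ eta * wedge u g * \det B by rewrite mulr_gt0.
  by rewrite -mulrA -detBE mulrCA pmulr_rgt0.
by rewrite /= fv vg fg.
Qed.

Definition black_frame : nat -> bool -> 'rV[R]_2 := cyclic_frame f v g.

(* The coefficients of [wedge_scale_mx] in the bases [(f, g)], [(u, f)] and [(u, g)],
   up to sign. *)
Definition white_scale (k : nat) (r : bool) : R :=
  match k with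
  | 0 => (wedge f g)^-1
  | 1 => (if r then a else - c) / wedge u f
  | _ => (if r then 1 else b) / wedge u g
  end.

Definition white_frame (k : nat) (r : bool) : 'rV[R]_2 :=
  white_scale k r *: perp (cyclic_frame (- g) u f (index k [:: 0; 2; 1]%N) r).

Lemma white_scale_oriented k r : 0 < (-1) ^+ eta * white_scale k r.
Proof.
have [a_gt0 b_gt0 c_lt0 _ _ _ uf ug fg] := frame.
case: k => [|[|k]] /=; [rewrite -[_^-1]div1r | |]; apply: oriented_div_gt0 => //;
  by case: r; rewrite ?oppr_gt0.
Qed.

Lemma pairwise_white_frame :
  pairwise (fun k l => positive_pair eta (white_frame k) (white_frame l))
    [:: 0; 2; 1]%N.
Proof.
have [_ _ _ _ _ _ uf ug fg] := frame.
have gof : pairwise (oriented eta) [:: - g; u; f].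
  by rewrite /= !oriented_oppl ug uf fg.
have := pairwise_cyclic_frame gof.
have -> : [:: 0; 1; 2]%N = [seq index k [:: 0; 2; 1]%N | k <- [:: 0; 2; 1]%N] by [].
rewrite pairwise_map; apply: sub_pairwise => k l.
by apply: positive_pair_scale_perp; apply: white_scale_oriented.
Qed.

Lemma hconn_frames (e : hedge) :
  hconn A B e = \sum_r (white_frame (val e.2) r)^T *m black_frame (val e.2) r.
Proof.
have [_ _ _ fA gB uA uf ug fg] := frame.
have trZ_mul (s : R) (x y : 'rV_2) : (s *: x)^T *m y = s *: (x^T *m y).
  by rewrite linearZ /= -scalemxAl.
rewrite big_bool /hconn; case: e.2 => [[|[|[|//]]] ?] /=;
  rewrite /white_frame /black_frame /= !trZ_mul.
- apply: (scalerI (oriented_neq0 fg)); rewrite scalerDr !scalerA.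
  rewrite divff ?(oriented_neq0 fg) // !scale1r wedge_scale_mx !mulmx1.
  by rewrite mulmxN !perpN !linearN /= !mulNmx opprK.
- apply: (scalerI (oriented_neq0 uf)); rewrite scalerDr !scalerA.
  rewrite !mulrA !(mulrAC _ _ (_^-1)) divff ?(oriented_neq0 uf) // !mul1r.
  by rewrite wedge_scale_mx fA uA -/v -!scalemxAr scaleNr.
- apply: (scalerI (oriented_neq0 ug)); rewrite scalerDr !scalerA.
  rewrite !mulrA !(mulrAC _ _ (_^-1)) divff ?(oriented_neq0 ug) // !mul1r scale1r addrC.
  by rewrite wedge_scale_mx gB -/v -!scalemxAr perpN linearN mulNmx.
Qed.

Lemma eigenframe_edge_frames : edge_frames A B eta black_frame white_frame.
Proof.
split; [|exact: pairwise_white_frame|exact: hconn_frames].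
exact: pairwise_cyclic_frame pairwise_oriented_fvg.
Qed.

End EigenframeDecomposition.

(** * Contraction at a vertex *)

Lemma big_fibers (T : Type) (idx : T) (op : Monoid.com_law idx) (I V : eqType)
    (r : seq I) (vs : seq V) (h : I -> V) (F : I -> T) :
  uniq vs -> {in r, forall i, h i \in vs} ->
  \big[op/idx]_(i <- r) F i =
  \big[op/idx]_(v <- vs) \big[op/idx]_(i <- r | h i == v) F i.
Proof.
move=> vs_uniq h_vs; rewrite (exchange_big_dep xpredT) //= big_seq [RHS]big_seq.
apply: eq_bigr => i /h_vs hi; rewrite -big_filter.
rewrite (_ : [seq v <- vs | h i == v] = [:: h i]) ?big_seq1 //.
by rewrite -(filter_pred1_uniq vs_uniq hi); apply: eq_filter => v; rewrite /= eq_sym.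
Qed.

Lemma prod_if_all (R : pzSemiRingType) (V : Type) (vs : seq V) (P : pred V)
    (F : V -> R) :
  \prod_(v <- vs) (if P v then F v else 0) =
  if all P vs then \prod_(v <- vs) F v else 0.
Proof.
elim: vs => [|v vs IHvs] /=; first by rewrite !big_nil.
by rewrite !big_cons IHvs; case: (P v); case: (all P vs); rewrite ?mul0r ?mulr0.
Qed.

Section SumProdFibers.
Variables (R : comNzRingType) (I X : finType) (x0 : X).

Lemma sum_prod_fin_fibers (V : finType) (h : I -> V) (F : V -> {ffun I -> X} -> R) :
  (forall v (S S' : {ffun I -> X}),
     (forall i, h i = v -> S i = S' i) -> F v S = F v S') ->
  \sum_S \prod_v F v S =
  \prod_v \sum_(S : {ffun I -> X} | [forall i, (h i != v) ==> (S i == x0)]) F v S.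
Proof.
move=> F_local; rewrite bigA_distr_big_dep.
pose restrict (S : {ffun I -> X}) : {ffun V -> {ffun I -> X}} :=
  [ffun v => [ffun i => if h i == v then S i else x0]].
pose glue (f : {ffun V -> {ffun I -> X}}) : {ffun I -> X} := [ffun i => f (h i) i].
rewrite [RHS](reindex_onto restrict glue) => [|f /familyP f_supp]; last first.
  apply/ffunP=> v; apply/ffunP=> i; rewrite !ffunE.
  case: eqVneq => [<-|hiv] //; apply/esym/eqP.
  by have /forallP /(_ i) /implyP := f_supp v; apply.
apply: eq_big => [S|S _].
  apply/esym/andP; split; last by apply/eqP/ffunP=> i; rewrite !ffunE eqxx.
  apply/familyP=> v; apply/forallP=> i; apply/implyP=> hiv.
  by rewrite !ffunE (negPf hiv).
by apply: eq_bigr => v _; apply: F_local => i hiv; rewrite !ffunE hiv eqxx.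
Qed.

Lemma sum_prod_fibers (V : eqType) (vs : seq V) (h : I -> V)
    (F : V -> {ffun I -> X} -> R) :
  uniq vs -> (forall i, h i \in vs) ->
  (forall v (S S' : {ffun I -> X}),
     (forall i, h i = v -> S i = S' i) -> F v S = F v S') ->
  \sum_S \prod_(v <- vs) F v S =
  \prod_(v <- vs)
    \sum_(S : {ffun I -> X} | [forall i, (h i != v) ==> (S i == x0)]) F v S.
Proof.
move=> vs_uniq h_vs F_local.
have tnth_inj : injective (tnth (in_tuple vs)) by apply/tuple_uniqP.
pose rank i := sval (seq_tnthP (h_vs i)).
have rankE i k : (rank i == k) = (h i == tnth (in_tuple vs) k).
  by rewrite /rank; case: seq_tnthP => j /= ->; rewrite (inj_eq tnth_inj).
transitivity (\sum_S \prod_k F (tnth (in_tuple vs) k) S).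
  by apply: eq_bigr => S _; rewrite (big_tnth _ _ vs).
rewrite [RHS](big_tnth _ _ vs) (sum_prod_fin_fibers (h := rank)) => [|k S S' SS'].
  by apply: eq_bigr => k _; apply: eq_bigl => S; apply: eq_forallb => i; rewrite rankE.
by apply: F_local => i /eqP; rewrite -rankE => /eqP; apply: SS'.
Qed.

End SumProdFibers.

Lemma filter_gt0_sum2 (T : Type) (L : seq T) (m : T -> nat) :
  (\sum_(i <- L) m i)%N = 2%N ->
  (exists2 i, [seq i <- L | (0 < m i)%N] = [:: i] & m i = 2%N) \/
  (exists i j, [/\ [seq i <- L | (0 < m i)%N] = [:: i; j], m i = 1%N & m j = 1%N]).
Proof.
have -> : (\sum_(i <- L) m i = \sum_(i <- [seq i <- L | 0 < m i]) m i)%N.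
  by rewrite big_filter [RHS]big_mkcond; apply: eq_bigr => i _; case: (m i).
have := filter_all (fun i => 0 < m i)%N L.
case: [seq i <- L | _] => [|i [|j [|k s]]]; rewrite ?big_cons ?big_nil //=.
- by left; exists i => //; lia.
- by right; exists i, j; split=> //; lia.
- by lia.
Qed.

Lemma sorted_colors0 : sorted_colors set0 = [::].
Proof. by rewrite /sorted_colors enum_set0. Qed.

Lemma sorted_colors1 a : sorted_colors [set a] = [:: a].
Proof. by rewrite /sorted_colors enum_set1. Qed.

Lemma sorted_colorsT : sorted_colors setT = [:: 0; 1].
Proof. by rewrite /sorted_colors enum_setT -enumT enum_ord2. Qed.

Lemma seq_sign_pair (R : numFieldType) (a b : 'I_2) :
  seq_sign R [:: a; b] = (-1) ^+ (b < a)%N.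
Proof.
rewrite /seq_sign /ninv /=; under eq_bigr do rewrite big_mkcond.
by rewrite !big_ord_recl !big_ord0 /= !addn0.
Qed.

Lemma perm_enum_ord2 (a b : 'I_2) : perm_eq [:: a; b] (enum 'I_2) = (b == rev_ord a).
Proof. by rewrite enum_ord2; move: a b; do 2!elim/forall_ord2. Qed.

Definition color_word (I : Type) (S : I -> {set 'I_2}) (L : seq I) : seq 'I_2 :=
  flatten [seq sorted_colors (S i) | i <- L].

Definition partitions_colors (I : Type) (S : I -> {set 'I_2}) (L : seq I) : bool :=
  perm_eq (color_word S L) (enum 'I_2).

Lemma color_word_ffun (I : finType) (S : I -> {set 'I_2}) (L : seq I) :
  color_word [ffun i => S i] L = color_word S L.
Proof. by congr flatten; apply: eq_map => i; rewrite ffunE. Qed.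

Section Contraction.
Variables (R : numFieldType) (I : finType) (m : I -> nat).
Implicit Types (L : seq I) (S : {ffun I -> {set 'I_2}}) (w : I -> {set 'I_2} -> R).

Definition vertex_coloring L S : bool :=
  [forall i, #|S i| == ((i \in L) * m i)%N] && partitions_colors S L.

(* The tensors [w i] live on the exterior algebra of the plane, with basis the sets of
   colors; [contraction w L] is the coefficient of the volume form in their product. *)
Definition contraction w L : R :=
  \sum_(S | vertex_coloring L S) seq_sign R (color_word S L) * \prod_(i <- L) w i (S i).

Lemma color_word_filter L S : (forall i, m i = 0%N -> S i = set0) ->
  color_word S L = color_word S [seq i <- L | (0 < m i)%N].
Proof.
move=> S0; rewrite /color_word; elim: L => //= i L ->.
by case: posnP => // /S0 ->; rewrite sorted_colors0.
Qed.

Lemma contraction_filter w L : (forall i, w i set0 = 1) ->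
  contraction w L = contraction w [seq i <- L | (0 < m i)%N].
Proof.
move=> w0; have S0 S : [forall i, #|S i| == ((i \in L) * m i)%N] ->
    forall i, m i = 0%N -> S i = set0.
  by move=> /forallP cardS i mi0; have := cardS i; rewrite mi0 muln0 cards_eq0 => /eqP.
apply: eq_big => [S|S /andP [/S0 {}S0 _]]; last first.
  rewrite -color_word_filter // big_filter [in RHS]big_mkcond; congr (_ * _).
  by apply: eq_bigr => i _; case: posnP => // /S0 ->.
transitivity ([forall i, #|S i| == ((i \in L) * m i)%N] &&
    partitions_colors S [seq i <- L | (0 < m i)%N]).
  rewrite /vertex_coloring; case: (boolP [forall i, _]) => // /S0 {}S0.
  by rewrite /partitions_colors (color_word_filter _ S0).
congr (_ && _); apply: eq_forallb => i.
by rewrite mem_filter; case: posnP => [->|]; rewrite ?muln0.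
Qed.

Lemma contraction_double w i : m i = 2%N -> contraction w [:: i] = w i setT.
Proof.
move=> mi; pose S0 := [ffun k => if k == i then setT else set0 : {set 'I_2}].
have wordS0 : color_word S0 [:: i] = [:: 0; 1].
  by rewrite /color_word /= ffunE eqxx sorted_colorsT.
rewrite /contraction (big_pred1 S0) => [|S] /=.
  by rewrite wordS0 seq_sign_pair mul1r big_seq1 ffunE eqxx.
apply/andP/eqP => [[/forallP cardS _]|->].
  apply/ffunP=> k; have /eqP := cardS k; rewrite ffunE inE.
  case: eqVneq => [->|_]; last by move/eqP; rewrite cards_eq0 => /eqP.
  by rewrite mi => cardSi; apply/eqP; rewrite eqEcard subsetT cardsT card_ord cardSi.
rewrite /partitions_colors wordS0 enum_ord2; split=> //.
apply/forallP=> k; rewrite ffunE inE.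
by case: (eqVneq k i) => [->|_]; rewrite ?cards0 // cardsT card_ord mi.
Qed.

Lemma contraction_pair w i j : i != j -> m i = 1%N -> m j = 1%N ->
  contraction w [:: i; j] = w i [set 0] * w j [set 1] - w i [set 1] * w j [set 0].
Proof.
move=> ij mi mj; have ji : (j == i) = false by rewrite eq_sym (negPf ij).
pose pair_coloring a : {ffun I -> {set 'I_2}} :=
  [ffun k => if k == i then [set a] else if k == j then [set rev_ord a] else set0].
have pair_coloring_i a : pair_coloring a i = [set a] by rewrite ffunE eqxx.
have pair_coloring_j a : pair_coloring a j = [set rev_ord a] by rewrite ffunE ji eqxx.
have word_pair a : color_word (pair_coloring a) [:: i; j] = [:: a; rev_ord a].
  by rewrite /color_word /= pair_coloring_i pair_coloring_j !sorted_colors1.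
pose first_color (S : {ffun I -> {set 'I_2}}) := head 0 (color_word S [:: i; j]).
rewrite /contraction (reindex_onto pair_coloring first_color); last first.
  move=> S /andP [/forallP cardS perm_word].
  have /cards1P [a Si] : #|S i| == 1%N by have := cardS i; rewrite mi inE eqxx.
  have /cards1P [b Sj] : #|S j| == 1%N by have := cardS j; rewrite mj !inE eqxx orbT.
  move: perm_word; rewrite /first_color /partitions_colors /color_word /= Si Sj.
  rewrite !sorted_colors1 /= perm_enum_ord2 => /eqP ba.
  apply/ffunP=> k; have := cardS k; rewrite ffunE !inE.
  case: (eqVneq k i) => [-> //|_]; case: (eqVneq k j) => [->|_]; first by rewrite Sj ba.
  by rewrite cards_eq0 => /eqP.
rewrite (eq_bigl xpredT) => [|a]; last first.
  rewrite /first_color /vertex_coloring /partitions_colors !word_pair perm_enum_ord2.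
  rewrite !eqxx !andbT.
  apply/forallP=> k; rewrite ffunE !inE.
  case: (eqVneq k i) => [->|_]; first by rewrite cards1 mi.
  by case: (eqVneq k j) => [->|_]; rewrite ?cards0 // cards1 mj.
rewrite sum_ord2 !word_pair !seq_sign_pair !big_cons !big_nil.
rewrite !pair_coloring_i !pair_coloring_j /=.
have [-> ->] : rev_ord 0 = 1 :> 'I_2 /\ rev_ord 1 = 0 :> 'I_2 by split; apply: val_inj.
by rewrite expr0 expr1; ring.
Qed.

Definition exterior (x : 'rV[R]_2) (y : R) (S : {set 'I_2}) : R :=
  match #|S| with
  | 0 => 1
  | 1 => \sum_(s in S) x 0 s
  | _ => y
  end.

Lemma exterior0 x y : exterior x y set0 = 1.
Proof. by rewrite /exterior cards0. Qed.

Lemma exterior1 x y s : exterior x y [set s] = x 0 s.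
Proof. by rewrite /exterior cards1 big_set1. Qed.

Lemma exteriorT x y : exterior x y setT = y.
Proof. by rewrite /exterior cardsT card_ord. Qed.

Lemma contraction_exterior_ind (P : R -> Prop) (x : I -> 'rV_2) (y : I -> R) L :
  uniq L -> (\sum_(i <- L) m i)%N = 2%N ->
  (forall i, P (y i)) -> (forall i j, subseq [:: i; j] L -> P (wedge (x i) (x j))) ->
  P (contraction (fun i => exterior (x i) (y i)) L).
Proof.
move=> L_uniq sum_m Py Px; rewrite contraction_filter => [|i]; last exact: exterior0.
have [[i Li mi]|[i [j [Lij mi mj]]]] := filter_gt0_sum2 sum_m.
  by rewrite Li contraction_double // exteriorT.
have sub_ij : subseq [:: i; j] L by rewrite -Lij filter_subseq.
have : uniq [:: i; j] by apply: subseq_uniq sub_ij L_uniq.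
rewrite /= inE andbT Lij => /contraction_pair -> //.
by rewrite !exterior1 [x i 0 1 * _]mulrC mulrC; apply: Px.
Qed.

End Contraction.

(** * Traces of webs *)

(* [inc v] lists the edges at [v] in cilium order, and [h i] is the end of [i] in [vs]. *)
Definition ciliated (I : finType) (V : eqType) (vs : seq V) (h : I -> V)
    (inc : V -> seq I) : Prop :=
  [/\ uniq vs, forall i, h i \in vs, forall v, uniq (inc v) &
      forall v i, (i \in inc v) = (h i == v)].

Definition half_coloring (I : finType) (V : eqType) (m : I -> nat) (vs : seq V)
    (inc : V -> seq I) (S : {ffun I -> {set 'I_2}}) : bool :=
  [forall i, #|S i| == m i] &&
  all (fun v => partitions_colors S (inc v)) vs.

Section HalfColorings.
Variables (R : numFieldType) (I : finType) (V : eqType) (m : I -> nat).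
Variables (vs : seq V) (h : I -> V) (inc : V -> seq I) (w : I -> {set 'I_2} -> R).
Hypothesis cil : ciliated vs h inc.
Implicit Types S : {ffun I -> {set 'I_2}}.

Definition colored_at S v : bool :=
  [forall i, (h i == v) ==> (#|S i| == m i)] &&
  partitions_colors S (inc v).

Lemma half_coloring_all S : half_coloring m vs inc S = all (colored_at S) vs.
Proof.
have [_ h_vs _ _] := cil.
apply/andP/allP => [[/forallP cardS /allP wordS] v v_vs|colS].
  by rewrite /colored_at wordS // andbT; apply/forallP=> i; rewrite cardS implybT.
split; last by apply/allP=> v /colS /andP [].
by apply/forallP=> i; have /andP [/forallP /(_ i)] := colS _ (h_vs i); rewrite eqxx.
Qed.

Lemma vertex_coloring_supported S v :
  vertex_coloring m (inc v) S =
  [forall i, (h i != v) ==> (S i == set0)] && colored_at S v.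
Proof.
have [_ _ _ mem_inc] := cil; rewrite andbA; congr (_ && _).
apply/forallP/andP => [cardS|[/forallP supp /forallP cardS] i].
  by split; apply/forallP=> i; have := cardS i; rewrite mem_inc;
    case: (eqVneq (h i) v) => //= _; rewrite ?mul1n ?mul0n ?cards_eq0.
have := supp i; have := cardS i; rewrite mem_inc.
by case: (eqVneq (h i) v) => _ /=; rewrite ?mul1n ?mul0n -?cards_eq0.
Qed.

Lemma sum_half_colorings :
  \sum_(S | half_coloring m vs inc S)
    (\prod_(v <- vs) seq_sign R (color_word S (inc v))) * \prod_i w i (S i) =
  \prod_(v <- vs) contraction m w (inc v).
Proof.
have [vs_uniq h_vs inc_uniq mem_inc] := cil.
pose F v S := if colored_at S v then
  seq_sign R (color_word S (inc v)) * \prod_(i | h i == v) w i (S i) else 0.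
rewrite big_mkcond; transitivity (\sum_S \prod_(v <- vs) F v S).
  apply: eq_bigr => S _.
  by rewrite prod_if_all big_split -(big_fibers _ _ vs_uniq) // half_coloring_all.
rewrite (sum_prod_fibers set0 vs_uniq h_vs) => [|v S S' SS']; last first.
  have wordSS' : color_word S (inc v) = color_word S' (inc v).
    by congr flatten; apply/eq_in_map => i; rewrite mem_inc => /eqP /SS' ->.
  rewrite /F /colored_at /partitions_colors wordSS'; congr (if _ && _ then _ * _ else _).
    by apply: eq_forallb => i; case: eqP => // /SS' ->.
  by apply: eq_bigr => i /eqP /SS' ->.
apply: eq_bigr => v _; rewrite -big_mkcondr.
apply: eq_big => [S|S _]; first by rewrite vertex_coloring_supported.
by rewrite big_uniq //; congr (_ * _); apply: eq_bigl => i; rewrite mem_inc.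
Qed.

End HalfColorings.

Lemma minor_exterior (R : numFieldType) (M : 'M[R]_2) (p q : bool -> 'rV[R]_2) (y z : R)
    (T S : {set 'I_2}) k :
  M = \sum_r (p r)^T *m q r -> \det M = y * z -> #|S| = k -> #|T| = k ->
  minor M T S k =
  \sum_(r | (k == 1%N) || ~~ r) exterior (p r) y T * exterior (q r) z S.
Proof.
move=> ME detM cardS cardT.
have sum_false (F : bool -> R) : \sum_(r | ~~ r) F r = F false.
  by apply: big_pred1 => -[].
have : (k <= 2)%N by rewrite -cardS -[leqRHS]card_ord max_card.
case: k cardS cardT => [|[|[|//]]] cardS cardT _.
- rewrite (cards0_eq cardS) (cards0_eq cardT) sum_false !exterior0 mulr1.
  exact: det_mx00.
- have /cards1P [s ->] : #|S| == 1%N by rewrite cardS.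
  have /cards1P [t ->] : #|T| == 1%N by rewrite cardT.
  rewrite /minor det_mx11 mxE !sorted_colors1 /= ME summxE.
  by apply: eq_bigr => r _; rewrite !exterior1 mxE big_ord1 mxE.
have cards2_setT (X : {set 'I_2}) : #|X| = 2%N -> X = setT.
  by move=> cardX; apply/eqP; rewrite eqEcard subsetT cardsT card_ord cardX.
rewrite (cards2_setT S) // (cards2_setT T) // sum_false !exteriorT -detM /minor.
by congr (\det _); apply/matrixP; rewrite !sorted_colorsT;
  elim/forall_ord2; elim/forall_ord2; rewrite mxE.
Qed.

Lemma minorZ (R : numFieldType) (s : R) (M : 'M[R]_2) T S k :
  minor (s *: M) T S k = s ^+ k * minor M T S k.
Proof. by rewrite /minor -detZ; congr (\det _); apply/matrixP=> i j; rewrite !mxE. Qed.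

Section Web.
Variables (R : numFieldType) (I : finType) (VB VW : eqType).
Variables (Bs : seq VB) (Ws : seq VW) (incB : VB -> seq I) (incW : VW -> seq I).
Variable m : I -> nat.

Definition web_coloring (c : {ffun I -> {set 'I_2} * {set 'I_2}}) : bool :=
  [&& [forall i, (#|(c i).1| == m i) && (#|(c i).2| == m i)],
      all (fun b => partitions_colors (fun i => (c i).1) (incB b)) Bs &
      all (fun w => partitions_colors (fun i => (c i).2) (incW w)) Ws].

Definition web_trace (phi : I -> 'M[R]_2) : R :=
  \sum_(c | web_coloring c)
    (\prod_(b <- Bs) seq_sign R (color_word (fun i => (c i).1) (incB b))) *
    (\prod_(w <- Ws) seq_sign R (color_word (fun i => (c i).2) (incW w))) *
    \prod_(i | (0 < m i)%N) minor (phi i) (c i).2 (c i).1 (m i).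

Lemma web_traceZ (s : I -> R) (phi psi : I -> 'M_2) :
  (forall i, psi i = s i *: phi i) ->
  web_trace psi = (\prod_i s i ^+ m i) * web_trace phi.
Proof.
move=> psiE; rewrite /web_trace mulr_sumr; apply: eq_bigr => c _.
rewrite mulrCA; congr (_ * _).
rewrite !(big_mkcond (fun i => (0 < m i)%N)) -big_split; apply: eq_bigr => i _ /=.
by case: posnP => [->|_]; rewrite ?psiE ?minorZ // expr0 mulr1.
Qed.

Lemma sum_web_colorings (F G : {ffun I -> {set 'I_2}} -> R) :
  \sum_(c | web_coloring c) F [ffun i => (c i).1] * G [ffun i => (c i).2] =
  (\sum_(S | half_coloring m Bs incB S) F S) *
  (\sum_(T | half_coloring m Ws incW T) G T).
Proof.
rewrite big_distrlr pair_big /=.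
pose split_coloring (c : {ffun I -> {set 'I_2} * {set 'I_2}}) :=
  ([ffun i => (c i).1] : {ffun I -> {set 'I_2}},
   [ffun i => (c i).2] : {ffun I -> {set 'I_2}}).
pose join_coloring (ST : {ffun I -> {set 'I_2}} * {ffun I -> {set 'I_2}}) :=
  [ffun i => (ST.1 i, ST.2 i)].
rewrite [RHS](reindex_onto split_coloring join_coloring) => [|[S T] _]; last first.
  by congr (_, _); apply/ffunP=> i; rewrite !ffunE.
apply: eq_bigl => c.
have -> : join_coloring (split_coloring c) = c.
  by apply/ffunP=> i; rewrite !ffunE; case: (c i).
rewrite eqxx andbT /half_coloring /= andbACA; congr [&& _, _ & _].
- apply/forallP/andP => [cardc|[/forallP card1 /forallP card2] i].
    by split; apply/forallP=> i; have /andP [] := cardc i; rewrite ffunE.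
  by have := card1 i; have := card2 i; rewrite !ffunE => -> ->.
- by apply: eq_all => b; rewrite /partitions_colors color_word_ffun.
- by apply: eq_all => w; rewrite /partitions_colors color_word_ffun.
Qed.

Section RankOneExpansion.
Variables (phi : I -> 'M[R]_2) (hB : I -> VB) (hW : I -> VW).
Variables (p q : I -> bool -> 'rV[R]_2) (y z : I -> R).
Hypotheses (ciliatedB : ciliated Bs hB incB) (ciliatedW : ciliated Ws hW incW).
Hypothesis phiE : forall i, phi i = \sum_r (p i r)^T *m q i r.
Hypothesis det_phi : forall i, \det (phi i) = y i * z i.

(* Only the edges of multiplicity 1 are expanded into two terms. *)
Definition expansion_choice (i : I) : pred bool := fun r => (m i == 1%N) || ~~ r.

Lemma web_trace_expansion :
  web_trace phi = \sum_(r : {ffun I -> bool} | r \in family expansion_choice)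
    (\prod_(b <- Bs) contraction m (fun i => exterior (q i (r i)) (z i)) (incB b)) *
    (\prod_(w <- Ws) contraction m (fun i => exterior (p i (r i)) (y i)) (incW w)).
Proof.
under eq_bigr => r _ do rewrite -(sum_half_colorings _ _ ciliatedB)
  -(sum_half_colorings _ _ ciliatedW) -sum_web_colorings.
rewrite exchange_big; apply: eq_bigr => c /and3P [/forallP cardc _ _] /=.
have -> : \prod_(i | (0 < m i)%N) minor (phi i) (c i).2 (c i).1 (m i) =
    \prod_i \sum_(r | expansion_choice i r)
      exterior (p i r) (y i) (c i).2 * exterior (q i r) (z i) (c i).1.
  rewrite big_mkcond; apply: eq_bigr => i _.
  have /andP [/eqP card1 /eqP card2] := cardc i.
  rewrite -(minor_exterior (phiE i) (det_phi i) card1 card2).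
  by case: posnP => // ->; rewrite /minor det_mx00.
rewrite bigA_distr_big_dep mulr_sumr; apply: eq_bigr => r _.
rewrite big_split /= [X in _ * X]mulrC mulrACA.
by congr (_ * _ * (_ * _)); apply: eq_bigr => ? _; rewrite ?color_word_ffun ?ffunE.
Qed.

End RankOneExpansion.
End Web.

Section ContractionSign.
Variables (R : realFieldType) (I : finType) (m : I -> nat) (eta : bool).
Variables (x : I -> bool -> 'rV[R]_2) (y : I -> R) (L : seq I).
Hypotheses (L_uniq : uniq L) (sum_m : (\sum_(i <- L) m i)%N = 2%N).
Hypothesis x_pos : pairwise (fun i j => positive_pair eta (x i) (x j)) L.
Hypothesis y_pos : forall i, 0 < (-1) ^+ eta * y i.

Lemma contraction_ge0 (r : I -> bool) :
  0 <= (-1) ^+ eta * contraction m (fun i => exterior (x i (r i)) (y i)) L.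
Proof.
apply: (@contraction_exterior_ind _ _ _ (fun z => 0 <= (-1) ^+ eta * z)) => //.
  by move=> i; apply: ltW.
move=> i j sub_ij.
have /andP [/andP [/andP [/forallP x_ge0 _] _] _] := subseq_pairwise sub_ij x_pos.
by have /forallP := x_ge0 (r i); apply.
Qed.

Lemma contraction_gt0 (r : I -> bool) : r =1 xpred0 ->
  0 < (-1) ^+ eta * contraction m (fun i => exterior (x i (r i)) (y i)) L.
Proof.
move=> r0.
apply: (@contraction_exterior_ind _ _ _ (fun z => 0 < (-1) ^+ eta * z)) => //.
move=> i j sub_ij.
by have /andP [/andP [/andP [_ ?] _] _] := subseq_pairwise sub_ij x_pos; rewrite !r0.
Qed.

End ContractionSign.

Lemma prod_signM (R : comPzRingType) (eta : bool) (VB VW : Type) (Bs : seq VB)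
    (Ws : seq VW) (F : VB -> R) (G : VW -> R) :
  size Bs = size Ws ->
  (\prod_(b <- Bs) F b) * (\prod_(w <- Ws) G w) =
  (\prod_(b <- Bs) ((-1) ^+ eta * F b)) * (\prod_(w <- Ws) ((-1) ^+ eta * G w)).
Proof.
move=> size_BsWs; rewrite !big_split /= !big_const_seq !count_predT !iter_mulr_1.
by rewrite size_BsWs mulrACA -exprMn -expr2 sqrr_sign expr1n mul1r.
Qed.

Lemma web_trace_gt0 (R : realFieldType) (I : finType) (VB VW : eqType) (Bs : seq VB)
    (Ws : seq VW) (hB : I -> VB) (hW : I -> VW) (incB : VB -> seq I)
    (incW : VW -> seq I) (m : I -> nat) (phi : I -> 'M[R]_2) (eta : bool)
    (p q : I -> bool -> 'rV[R]_2) :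
  ciliated Bs hB incB -> ciliated Ws hW incW -> size Bs = size Ws ->
  {in Bs, forall b, (\sum_(i <- incB b) m i)%N = 2%N} ->
  {in Ws, forall w, (\sum_(i <- incW w) m i)%N = 2%N} ->
  (forall b, pairwise (fun i j => positive_pair eta (q i) (q j)) (incB b)) ->
  (forall w, pairwise (fun i j => positive_pair eta (p i) (p j)) (incW w)) ->
  (forall i, phi i = \sum_r (p i r)^T *m q i r) -> (forall i, 0 < \det (phi i)) ->
  0 < web_trace Bs Ws incB incW m phi.
Proof.
move=> cilB cilW size_BsWs sumB sumW posB posW phiE det_gt0.
have [_ _ uniqB _] := cilB; have [_ _ uniqW _] := cilW.
rewrite (web_trace_expansion m (y := fun i => (-1) ^+ eta * \det (phi i))
  (z := fun=> (-1) ^+ eta) cilB cilW phiE) => [|i]; last first.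
  by rewrite mulrC mulrA -expr2 sqrr_sign mul1r.
have y_gt0 i : 0 < (-1) ^+ eta * ((-1) ^+ eta * \det (phi i)) by rewrite signrMK.
have z_gt0 (i : I) : 0 < (-1) ^+ eta * (-1) ^+ eta :> R by rewrite -expr2 sqrr_sign.
pose r0 : {ffun I -> bool} := [ffun=> false].
have r0_false : r0 =1 xpred0 by move=> i; rewrite ffunE.
rewrite (bigD1 r0) /=; last by apply/familyP=> i; rewrite r0_false unfold_in orbT.
apply: ltr_pwDl.
  rewrite (prod_signM eta) // !big_seq mulr_gt0 // prodr_gt0 // => v v_in.
    exact: contraction_gt0 (sumB v v_in) (posB v) z_gt0 _ r0_false.
  exact: contraction_gt0 (sumW v v_in) (posW v) y_gt0 _ r0_false.
apply: sumr_ge0 => r _; rewrite (prod_signM eta) // !big_seq.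
rewrite mulr_ge0 // prodr_ge0 // => v v_in.
  exact: contraction_ge0 (sumB v v_in) (posB v) z_gt0 _.
exact: contraction_ge0 (sumW v v_in) (posW v) y_gt0 _.
Qed.

(** * The honeycomb *)

Lemma hblack_inj e e' : hblack e = hblack e' -> e.2 = e'.2 -> e = e'.
Proof. by case: e e' => [b k] [b' k'] /= -> ->. Qed.

Lemma hwhite_inj e e' : hwhite e = hwhite e' -> e.2 = e'.2 -> e = e'.
Proof.
case: e e' => [[x y] k] [[x' y'] k'] /= + kk'; rewrite /hwhite /= kk'.
by move=> [/addIr -> /addIr ->].
Qed.

Definition edge_type (E : seq hedge) (i : 'I_(size E)) : nat := val (eE E i).2.

Definition incident_of_type (V : eqType) (h : hedge -> V) (E : seq hedge) (v : V)
    (k : nat) : seq 'I_(size E) :=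
  [seq i <- enum 'I_(size E) | (h (eE E i) == v) && (edge_type i == k)].

Definition incident (V : eqType) (h : hedge -> V) (ks : seq nat) (E : seq hedge)
    (v : V) : seq 'I_(size E) :=
  flatten [seq incident_of_type h E v k | k <- ks].

Lemma pairwise_subsingleton (T : eqType) (r : rel T) (s : seq T) :
  uniq s -> {in s &, forall x y, x = y} -> pairwise r s.
Proof.
case: s => [|x [|y s]] //= /andP [x_notin _] /(_ x y).
by rewrite !inE !eqxx orbT => /(_ isT isT) xy; rewrite xy inE eqxx in x_notin.
Qed.

Section Incident.
Variables (V : eqType) (h : hedge -> V) (E : seq hedge).
Hypothesis h_inj : forall e e', h e = h e' -> e.2 = e'.2 -> e = e'.
Hypothesis E_uniq : uniq E.

Lemma eE_inj : injective (eE E).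
Proof. by move=> i j /eqP; rewrite nth_uniq // => /eqP; apply: val_inj. Qed.

Lemma mem_incident_of_type v k i :
  (i \in incident_of_type h E v k) = (h (eE E i) == v) && (edge_type i == k).
Proof. by rewrite mem_filter mem_enum andbT. Qed.

Lemma pairwise_incident (r : rel nat) (ks : seq nat) v : pairwise r ks ->
  pairwise (fun i j => r (edge_type i) (edge_type j)) (incident h ks E v).
Proof.
rewrite /incident; elim: ks => //= k ks IHks /andP [/allP r_k /IHks {}IHks].
rewrite pairwise_cat IHks andbT; apply/andP; split.
  apply/allrelP=> i j; rewrite mem_incident_of_type => /andP [_ /eqP ->].
  move=> /flatten_mapP [l l_ks].
  by rewrite mem_incident_of_type => /andP [_ /eqP ->]; apply: r_k.
apply: pairwise_subsingleton; first by rewrite filter_uniq ?enum_uniq.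
move=> i j; rewrite !mem_incident_of_type.
move=> /andP [/eqP hi /eqP ki] /andP [/eqP hj /eqP kj].
by apply/eE_inj/h_inj; [rewrite hi | apply/val_inj; rewrite -[LHS]/(edge_type i) ki].
Qed.

Section CiliatedIncident.
Variables (ks : seq nat) (vs : seq V).
Hypothesis ks_perm : perm_eq ks [:: 0; 1; 2]%N.
Hypotheses (vs_uniq : uniq vs) (h_vs : {in E, forall e, h e \in vs}).

Lemma mem_incident v i : (i \in incident h ks E v) = (h (eE E i) == v).
Proof.
apply/flatten_mapP/eqP => [[k _]|<-].
  by rewrite mem_incident_of_type => /andP [/eqP].
exists (edge_type i); last by rewrite mem_incident_of_type !eqxx.
by rewrite (perm_mem ks_perm) /edge_type; case: (eE E i).2 => [[|[|[|]]]].
Qed.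

Lemma ciliated_incident : ciliated vs (fun i => h (eE E i)) (incident h ks E).
Proof.
split=> [//|i|v|v i]; [exact/h_vs/mem_nth | | exact: mem_incident].
have : pairwise [rel k l | k != l] ks by rewrite -uniq_pairwise (perm_uniq ks_perm).
by move=> /(pairwise_incident v); apply: pairwise_uniq => i; rewrite /= eqxx.
Qed.

End CiliatedIncident.
End Incident.

Lemma sum_ciliated (E : seq hedge) (V : eqType) (vs : seq V) (h : hedge -> V)
    (inc : V -> seq 'I_(size E)) (F : hedge -> nat) v :
  ciliated vs (fun i => h (eE E i)) inc ->
  (\sum_(i <- inc v) F (eE E i) = \sum_(e <- E | h e == v) F e)%N.
Proof.
move=> [_ _ inc_uniq mem_inc]; rewrite big_uniq //= (big_nth he0) big_mkord.
by apply: eq_bigl => i; rewrite mem_inc.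
Qed.

Section HoneycombWeb.
Variables (Bs Ws : seq (int * int)) (E : seq hedge) (m : hedge -> nat).
Hypothesis subgraphE : honeycomb_subgraph Bs Ws E.
Hypothesis multiwebm : is_2multiweb Bs Ws E m.

Lemma ciliated_black :
  ciliated Bs (fun i => hblack (eE E i)) (incident hblack [:: 0; 1; 2]%N E).
Proof.
have /and4P [Bs_uniq _ E_uniq /allP E_ends] := subgraphE.
by apply: (ciliated_incident hblack_inj) => // e /E_ends /andP [].
Qed.

Lemma ciliated_white :
  ciliated Ws (fun i => hwhite (eE E i)) (incident hwhite [:: 0; 2; 1]%N E).
Proof.
have /and4P [_ Ws_uniq E_uniq /allP E_ends] := subgraphE.
by apply: (ciliated_incident hwhite_inj) => // e /E_ends /andP [].
Qed.

Lemma trace2_web (R : numFieldType) (A B : 'M[R]_2) :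
  trace2 A B Bs Ws E m =
  web_trace Bs Ws (incident hblack [:: 0; 1; 2]%N E) (incident hwhite [:: 0; 2; 1]%N E)
    (fun i => m (eE E i)) (fun i => hconn A B (eE E i)).
Proof. by []. Qed.

Lemma trace2_gt0_edge_frames (R : realFieldType) (A B : 'M[R]_2) eta q p :
  edge_frames A B eta q p -> 0 < \det A -> 0 < \det B -> size Bs = size Ws ->
  0 < trace2 A B Bs Ws E m.
Proof.
move=> [q_pos p_pos hconnE] detA detB size_BsWs.
have /and4P [_ _ E_uniq _] := subgraphE; have [sumB sumW] := multiwebm.
rewrite trace2_web; apply: (web_trace_gt0 (q := fun i => q (edge_type i))
  (p := fun i => p (edge_type i)) ciliated_black ciliated_white size_BsWs).
- by move=> b /sumB; apply: etrans; exact: (sum_ciliated m _ ciliated_black).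
- by move=> w /sumW; apply: etrans; exact: (sum_ciliated m _ ciliated_white).
- by move=> b; apply: (pairwise_incident hblack_inj E_uniq b q_pos).
- by move=> w; apply: (pairwise_incident hwhite_inj E_uniq w p_pos).
- by move=> i; apply: hconnE.
- by move=> i; rewrite /hconn; do 2?case: ifP => _ //; rewrite det1.
Qed.

End HoneycombWeb.

Lemma sum_regular_fibers (M : nmodType) (I V : eqType) (E : seq I) (vs : seq V)
    (h : I -> V) (m : I -> nat) (n : nat) (c : V -> M) :
  uniq vs -> {in E, forall e, h e \in vs} ->
  {in vs, forall v, (\sum_(e <- E | h e == v) m e)%N = n} ->
  \sum_(e <- E) c (h e) *+ m e = (\sum_(v <- vs) c v) *+ n.
Proof.
move=> vs_uniq h_vs sum_m; rewrite (big_fibers _ _ vs_uniq h_vs) -sumrMnl.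
apply: eq_big_seq => v v_vs; rewrite -(sum_m v v_vs) -sumrMnr.
by apply: eq_bigr => e /eqP ->.
Qed.

Definition type_degree (E : seq hedge) (m : hedge -> nat) (k : nat) : nat :=
  (\sum_(e <- E | val e.2 == k) m e)%N.

Section Parity.
Variables (Bs Ws : seq (int * int)) (E : seq hedge) (m : hedge -> nat).
Hypothesis subgraphE : honeycomb_subgraph Bs Ws E.
Hypothesis multiwebm : is_2multiweb Bs Ws E m.

(* The edges of type 1 (resp. 2) are those along which the first (resp. second)
   coordinate grows, by 1, from black to white. *)
Lemma type_degree_even k : (0 < k < 3)%N -> ~~ odd (type_degree E m k).
Proof.
move=> k_range; have /and4P [Bs_uniq Ws_uniq _ /allP E_ends] := subgraphE.
have [sumB sumW] := multiwebm.
pose c (v : int * int) := if k == 1%N then v.1 else v.2.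
have c_step e : c (hwhite e) - c (hblack e) = (val e.2 == k)%:R.
  rewrite /c /hwhite /hblack /hshift {c}; case: e => [[x y] [[|[|[|//]]] ?]] /=;
  by case: k k_range => [|[|[|//]]] //= _; ring.
have degE : (type_degree E m k)%:Z = (\sum_(w <- Ws) c w - \sum_(b <- Bs) c b) *+ 2.
  rewrite mulrnBl -(sum_regular_fibers c Ws_uniq _ sumW) => [|e /E_ends /andP [] //].
  rewrite -(sum_regular_fibers c Bs_uniq _ sumB) => [|e /E_ends /andP [] //].
  rewrite -sumrB /type_degree -natz natr_sum big_mkcond; apply: eq_bigr => e _ /=.
  by rewrite -mulrnBl c_step; case: eqP => _; rewrite ?mul0rn // natz.
rewrite -dvdn2 -[(_ %| _)%N]/((2%N%:Z %| _%N%:Z)%Z) degE -mulr_natl.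
exact/dvdz_mulr/dvdzz.
Qed.

Lemma trace2Z (R : numFieldType) (A B : 'M[R]_2) (s t : R) :
  trace2 (s *: A) (t *: B) Bs Ws E m =
  s ^+ type_degree E m 1 * t ^+ type_degree E m 2 * trace2 A B Bs Ws E m.
Proof.
pose scale k := match k with 0 => 1 | 1 => s | _ => t end.
have hconnZ i :
    hconn (s *: A) (t *: B) (eE E i) = scale (edge_type i) *: hconn A B (eE E i).
  rewrite /hconn /edge_type; case: (eE E i).2 => [[|[|[|//]]] ?] //=.
  by rewrite scale1r.
rewrite !trace2_web (web_traceZ _ _ _ _ _ hconnZ).
congr (_ * _); rewrite /type_degree !expr_sum.
rewrite !(big_mkcond (fun e : hedge => _ == _)) -big_split.
rewrite [RHS](big_nth he0) big_mkord; apply: eq_bigr => i _.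
rewrite /edge_type /eE; case: (nth he0 E i).2 => [[|[|[|//]]] ?] /=;
  by rewrite ?expr1n ?mulr1 ?mul1r.
Qed.

Lemma trace2_sign (R : numFieldType) (A B : 'M[R]_2) (s t : bool) :
  trace2 ((-1) ^+ s *: A) ((-1) ^+ t *: B) Bs Ws E m = trace2 A B Bs Ws E m.
Proof.
have sign_even (b : bool) k :
    (0 < k < 3)%N -> ((-1) ^+ b) ^+ type_degree E m k = 1 :> R.
  by move=> /type_degree_even /negPf even_k; rewrite exprAC -signr_odd even_k expr1n.
by rewrite trace2Z !sign_even // !mul1r.
Qed.

End Parity.

Lemma sign_condition_normalize (R : realType) (A B : 'M[R]_2) :
  B \in unitmx -> sign_condition A B ->
  exists s t : bool, let A' := (-1) ^+ s *: A in let B' := (-1) ^+ t *: B in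
    [/\ B' \in unitmx, eig_pos A', eig_pos B' & eig_neg (A' *m invmx B')].
Proof.
move=> unitB signs.
have unitZ (t : bool) : (-1) ^+ t *: B \in unitmx by rewrite unitmxZ // unitrX ?unitrN1.
have ratioE (s t : bool) : ((-1) ^+ s *: A) *m invmx ((-1) ^+ t *: B) =
    (-1) ^+ (s (+) t) *: (A *m invmx B).
  by rewrite invmxZ // invr_sign -scalemxAl -scalemxAr scalerA signr_addb.
suff [s [t [posA posB negAB]]] : exists s t : bool, [/\ eig_pos ((-1) ^+ s *: A),
    eig_pos ((-1) ^+ t *: B) & eig_neg ((-1) ^+ (s (+) t) *: (A *m invmx B))].
  by exists s, t; rewrite /= ratioE.
case: signs => -[A_sign B_sign AB_sign];
  [exists false, false | exists false, true | exists true, false | exists true, true];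
  by rewrite /= ?expr0 ?expr1 ?scale1r ?scaleN1r; split=> //;
    (exact: eig_neg_opp || exact: eig_pos_opp).
Qed.

Theorem theorem6 (R : realType) (A B : 'M[R]_2) :
  A \in unitmx -> B \in unitmx -> sign_condition A B ->
  forall (Bs Ws : seq (int * int)) (E : seq hedge),
    honeycomb_subgraph Bs Ws E -> size Bs = size Ws ->
  forall m : hedge -> nat, is_2multiweb Bs Ws E m ->
    0 < trace2 A B Bs Ws E m.
Proof.
move=> _ unitB signs Bs Ws E subgraphE size_BsWs m multiwebm.
have [s [t [unitB' posA posB negAB]]] := sign_condition_normalize unitB signs.
rewrite -(trace2_sign subgraphE multiwebm A B s t).
have [eta [u [f [g [a [b [c frame]]]]]]] := exists_eigenframe unitB' posA posB negAB.
have detA := eig_pos_det_gt0 posA; have detB := eig_pos_det_gt0 posB.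
have frames := eigenframe_edge_frames detA detB frame.
exact: trace2_gt0_edge_frames frames detA detB size_BsWs.
Qed.
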